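(* Assume the true joint propensity score factorizes as $\psi(t,z;\mathbf{x})=p(t,z\mid\mathbf{x})=\phi(z;\mathbf{x}_z)\,e(t;\mathbf{x}_t)$, and let $e_\eta$, $\phi_\eta$ be positive estimates satisfying the bounded odds-ratio condition: there exist $\Gamma_t\ge1$ and $\Gamma_z\ge1$ such that for all $t,\mathbf{x}_t$, $\frac{1}{\Gamma_t}\le \frac{e_\eta(t;\mathbf{x}_t)}{e(t;\mathbf{x}_t)}\le\Gamma_t$, and for all $z,\mathbf{x}_z$, $\frac{1}{\Gamma_z}\le\frac{\phi_\eta(z;\mathbf{x}_z)}{\phi(z;\mathbf{x}_z)}\le\Gamma_z$. Let the weights be $w_\eta(t,z,\mathbf{x})=\frac{1}{\phi_\eta(z;\mathbf{x}_z)e_\eta(t;\mathbf{x}_t)}$, let $\Phi:\mathcal{X}'\to\mathcal{R}$ be a one-to-one representation, and assume $\mathcal{R}$ is bounded with $\mathrm{diam}(\mathcal{R})=\sup_{r,r'\in\mathcal{R}}\|r-r'\|_2$. Then $$\mathcal{W}\big(p_\Phi(r)p(t,z),\,q_{\Phi,\eta}(r\mid t,z)p(t,z)\big)\le \mathrm{diam}(\mathcal{R})\sqrt{\log\Gamma_t+\log\Gamma_z}.$$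
   Context: Setting: each unit has combined features $\mathbf{x}\in\mathcal{X}'=\mathcal{X}\times\mathcal{X}^{|\mathcal{N}|}$ (own and neighbours' features), binary treatment $t\in\{0,1\}$ and neighbourhood exposure $z\in[0,1]$, with joint distribution having marginals $p(\mathbf{x})$, $p(t,z)$, conditionals $p(\mathbf{x}\mid t,z)$ and $p(t,z\mid\mathbf{x})$; overlap holds, i.e. $p(t,z\mid\mathbf{x})>0$. $\mathbf{x}_t$ and $\mathbf{x}_z$ are sub-vectors of $\mathbf{x}$ (the features directly affecting $t$ and $z$ respectively); $e(t;\mathbf{x}_t)=p(t\mid\mathbf{x}_t)$ is the individual propensity score and $\phi(z;\mathbf{x}_z)=p(z\mid\mathbf{x}_z)$ the neighbourhood propensity score. Reweighted distribution: $q_\eta(\mathbf{x}\mid t,z)=w_\eta(t,z,\mathbf{x})p(\mathbf{x}\mid t,z)/c(t,z)$ with $c(t,z)=\int w_\eta(t,z,\mathbf{x})p(\mathbf{x}\mid t,z)d\mathbf{x}$ (assumed finite). $p_\Phi(r)$ and $q_{\Phi,\eta}(r\mid t,z)$ are the distributions of $r=\Phi(\mathbf{x})$ under $p(\mathbf{x})$ and $q_\eta(\mathbf{x}\mid t,z)$. $p_\Phi(r)p(t,z)$ denotes the product distribution on $\mathcal{R}\times\{0,1\}\times[0,1]$, and $q_{\Phi,\eta}(r\mid t,z)p(t,z)$ the joint distribution with $(t,z)\sim p(t,z)$ and $r\sim q_{\Phi,\eta}(\cdot\mid t,z)$. $\mathcal{W}$ denotes the 1-Wasserstein distance between distributions on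 $\mathcal{R}\times\{0,1\}\times[0,1]$ with respect to the ground cost $d((r,t,z),(r',t',z'))=\|r-r'\|_2$. *)

(* Defs.v *)
From HB Require Import structures.
From mathcomp Require Import all_boot all_order all_algebra.
From mathcomp Require Import all_classical all_reals all_analysis.
Set Implicit Arguments.
Unset Strict Implicit.
Unset Printing Implicit Defensive.
Import Order.TTheory GRing.Theory Num.Theory.
Import numFieldNormedType.Exports.
Local Open Scope classical_set_scope.
Local Open Scope ring_scope.

Section Defs.
Variable R : realType.

(* Representation space R^d (product = Borel sigma-algebra) with the
   Euclidean distance. *)
Definition dist2 (d : nat) (r r' : d.-tuple R) : R :=
  Num.sqrt (\sum_(i < d) (tnth r i - tnth r' i) ^+ 2).

Definition diam (d : nat) (calR : set (d.-tuple R)) : R :=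
  sup [set dist2 r r' | r in calR & r' in calR].

(* The space R x {0,1} x [0,1] (z lives in R, all laws put mass on [0,1]). *)
Definition out_space (d : nat) := ((d.-tuple R * bool) * R)%type.

Definition ground_cost (d : nat) (a b : out_space d) : \bar R :=
  (dist2 a.1.1 b.1.1)%:E.

Definition coupling (d : nat) (P Q : set (out_space d) -> \bar R)
  (g : probability (out_space d * out_space d)%type R) : Prop :=
  forall A : set (out_space d), measurable A ->
    g (A `*` setT) = P A /\ g (setT `*` A) = Q A.

Definition W1 (d : nat) (P Q : set (out_space d) -> \bar R) : \bar R :=
  ereal_inf [set x | exists g : probability (out_space d * out_space d)%type R,
     coupling P Q g /\ x = \int[g]_u ground_cost u.1 u.2]%E.

Section Laws.
Context {dX dt dz : measure_display} (X : measurableType dX)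
  (Xt : measurableType dt) (Xz : measurableType dz).
Variables (PX : probability X R) (pt : X -> Xt) (pz : X -> Xz)
  (e : bool -> Xt -> R) (phi : R -> Xz -> R)
  (eh : bool -> Xt -> R) (phih : R -> Xz -> R)
  (d : nat) (Phi : X -> d.-tuple R).

Definition psi (x : X) (t : bool) (z : R) : R := phi z (pz x) * e t (pt x).

Definition w_eta (t : bool) (z : R) (x : X) : R :=
  (phih z (pz x) * eh t (pt x))^-1.

(* marginal density p(t,z) (w.r.t. counting x Lebesgue on [0,1]) *)
Definition p_tz (t : bool) (z : R) : \bar R :=
  (\int[PX]_x (psi x t z)%:E)%E.

Definition cp_tz (t : bool) (z : R) : \bar R :=
  (\int[PX]_x (w_eta t z x * psi x t z)%:E)%E.

Definition law_prod (A : set (out_space d)) : \bar R :=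
  (\sum_(t : bool) \int[lebesgue_measure]_(z in `[0%R, 1%R])
     (p_tz t z * \int[PX]_x (\1_A ((Phi x, t), z))%:E))%E.

(* law q_{Phi,eta}(r|t,z) p(t,z), where
   q_eta(dx|t,z) = w_eta psi dP_X(x) / int w_eta psi dP_X *)
Definition law_q (A : set (out_space d)) : \bar R :=
  (\sum_(t : bool) \int[lebesgue_measure]_(z in `[0%R, 1%R])
     (p_tz t z *
      (\int[PX]_x (w_eta t z x * psi x t z * \1_A ((Phi x, t), z))%:E
        * ((fine (cp_tz t z))^-1)%:E)))%E.

End Laws.
End Defs.

(* Main.v *)
Require Import Defs.
From HB Require Import structures.
From mathcomp Require Import all_boot all_order all_algebra.
From mathcomp Require Import all_classical all_reals all_analysis.
From mathcomp Require Import measurable_realfun ring lra.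
Import Order.TTheory GRing.Theory Num.Theory.
Import numFieldNormedType.Exports.
Local Open Scope classical_set_scope.
Local Open Scope ring_scope.

(* Let [G = Gt * Gz] and [L = ln G]. For [z] in [0,1] the product [v] of the
   weight and the propensity lies in [[1/G, G]], hence so does its mean [c], and
   the density [v / c] of [q(x|t,z)] with respect to [p(x)] is at least
   [k = G^-2 = exp(-2L)]. Thus the second law dominates [k] times the first law
   [P], say it is [k P + D] with [D >= 0] of mass [1 - k]. Leaving the mass
   [k P] in place and coupling the rest of [P] independently with [D] costs at most
   [diam * (1 - k)], and [1 - exp(-2 s^2) <= s] at [s = sqrt L]. *)

(** * A scalar inequality for the exponential *)

(** For [s <= 1/2] the bound [exp x >= 1 + x] suffices, since [2 s^2 <= s]. For [1/2 < s < 1] that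
    is too weak, so it is applied to [exp(- s^2 / 2)] and raised to the fourth power. *)
Lemma one_sub_expRN_le (R : realType) (s : R) : 0 <= s ->
  1 - expR (- (2 * s ^+ 2)) <= s.
Proof.
move=> s0; have [s1|s1] := leP 1 s.
  by have := expR_ge0 (- (2 * s ^+ 2)); lra.
have e4 : (1 - s ^+ 2 / 2) ^+ 4 <= expR (- (2 * s ^+ 2)).
  have -> : - (2 * s ^+ 2) = - (s ^+ 2 / 2) * 4%:R by lra.
  rewrite expRM_natr lerXn2r ?nnegrE ?expR_ge0//; first by nra.
  by have := expR_ge1Dx (- (s ^+ 2 / 2)); lra.
have [s2|s2] := leP s (1/2).
  have := expR_ge1Dx (- (2 * s ^+ 2)); nra.
(* The convex function [b ^+ 4] lies above its tangent at [m]. At [b = 1 - s^2 / 2] the tangent is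
   quadratic in [s]. *)
have tangent (m b : R) : m ^+ 4 + 4 * m ^+ 3 * (b - m) <= b ^+ 4.
  have : 0 <= (b - m) ^+ 2 * ((b + m) ^+ 2 + 2 * m ^+ 2).
    apply: mulr_ge0; first exact: sqr_ge0.
    by have := sqr_ge0 (b + m); have := sqr_ge0 m; lra.
  rewrite (_ : _ * _ = b ^+ 4 - (m ^+ 4 + 4 * m ^+ 3 * (b - m))).
    by rewrite subr_ge0.
  by ring.
(* the two tangent points were chosen so that the resulting quadratics in [s]
   cover [1/2, 3/4] and [3/4, 1] *)
have [s3|s3] := leP s (3/4).
  have := tangent (31/40) (1 - s ^+ 2 / 2); nra.
have := tangent (13/20) (1 - s ^+ 2 / 2); nra.
Qed.

(** * Measures from densities, and a transport bound *)

Lemma induced_measure (d : measure_display) (T : measurableType d)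
  (R : realType) (mu : {measure set T -> \bar R}) (f : T -> \bar R) :
  measurable_fun setT f -> (forall x, 0 <= f x)%E ->
  exists m : {measure set T -> \bar R},
    forall A, m A = (\int[mu]_(x in A) f x)%E.
Proof.
move=> mf f0; pose m A := (\int[mu]_(x in A) f x)%E.
pose ax := isMeasure.Build _ _ _ m (integral_set0 _ _)
  (fun A => @integral_ge0 _ _ _ mu A f (fun x _ => f0 x))
  (semi_sigma_additive_nng_induced mf f0).
pose M : {measure set T -> \bar R} := HB.pack m ax.
by exists M.
Qed.

Lemma measurable_ground_cost (R : realType) (d : nat) :
  measurable_fun setT
    (fun u : out_space R d * out_space R d => ground_cost u.1 u.2).
Proof.
apply/measurable_EFinP; rewrite /dist2.
apply: (measurableT_comp (continuous_measurable_fun (@sqrt_continuous R))).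
apply: measurable_sum => i.
apply: measurable_funX; apply: measurable_funB.
  apply: (measurableT_comp (measurable_tnth i)).
  apply: (measurableT_comp measurable_fst).
  by apply: (measurableT_comp measurable_fst).
apply: (measurableT_comp (measurable_tnth i)).
apply: (measurableT_comp measurable_fst).
by apply: (measurableT_comp measurable_fst).
Qed.

Lemma probability_of_measure (d : measure_display) (T : measurableType d)
  (R : realType) (m : {measure set T -> \bar R}) :
  m setT = 1%E -> exists p : probability T R, forall A, p A = m A.
Proof.
case: m => m cm /= m1.
pose M : {measure set T -> \bar R} := Measure.Pack cm.
pose ax := Measure_isProbability.Build _ _ _ (Measure.sort M) m1.
pose p : probability T R := HB.pack (Measure.sort M) ax.
by exists p.
Qed.

(** Only the mass [1 - k] that is not common to both laws has to move, and each unit of it pays at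
    most [M]. The laws are images under [h] because distances are bounded on the range of [h] only,
    not on the whole outcome space. *)
Lemma W1_le_of_minorization (R : realType) (d : nat) (dS : measure_display)
  (S : measurableType dS) (h : S -> out_space R d)
  (P D : {measure set S -> \bar R}) (LP LQ : set (out_space R d) -> \bar R)
  (k M : R) :
  measurable_fun setT h -> 0 <= k <= 1 -> 0 <= M ->
  P setT = 1%E -> D setT = (1 - k)%:E ->
  (forall A, measurable A -> LP A = P (h @^-1` A)) ->
  (forall A, measurable A -> LQ A = (k%:E * P (h @^-1` A) + D (h @^-1` A))%E) ->
  (forall s s', dist2 (h s).1.1 (h s').1.1 <= M) ->
  (W1 LP LQ <= (M * (1 - k))%:E)%E.
Proof.
move=> mh /andP[k0 k1] M0 PT DT LPE LQE hM.
have [P' P'E] := probability_of_measure _ _ _ _ PT.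
have mdiag : measurable_fun setT (fun s => (h s, h s)).
  exact: measurable_fun_pair.
(* The second factor of the product is the probability [P'], which carries the finiteness structure
   that the bare measure [D] does not; the swap sends it to the first marginal. *)
have mswap : measurable_fun setT (fun u : S * S => (h u.2, h u.1)).
  by apply: measurable_fun_pair; apply: (measurableT_comp mh).
pose kn : {nonneg R} := NngNum k0.
(* [k * P] moved along the diagonal plus the independent product [P x D]; the
   cost ignores [(t, z)], so the product part need not preserve it *)
pose g1 : {measure set (out_space R d * out_space R d) -> \bar R} :=
  pushforward P (fun s => (h s, h s)).
pose g2 : {measure set (out_space R d * out_space R d) -> \bar R} :=
  pushforward (D \x P')%E (fun u : S * S => (h u.2, h u.1)).
pose g : {measure set (out_space R d * out_space R d) -> \bar R} :=
  measure_add (mscale kn (g1 mdiag)) (g2 mswap).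
have mpre A : measurable A -> measurable (h @^-1` A).
  by move=> mA; rewrite -[X in measurable X]setTI; exact: mh.
have gE (A B : set (out_space R d)) : measurable A -> measurable B ->
    g (A `*` B) = (k%:E * P (h @^-1` (A `&` B))
                   + D (h @^-1` B) * P (h @^-1` A))%E.
  move=> mA mB; etransitivity; first exact: measure_addE.
  congr (_ + _)%E.
  rewrite -!P'E -product_measure1E; [|exact: mpre..].
  by congr ((D \x P')%E _); apply/seteqP; split => -[x y] /= [].
have gT : g setT = 1%E.
  by rewrite -setXTT gE// setTI preimage_setT PT DT mule1 mule1 -EFinD subrKC.
have [G GE] := probability_of_measure _ _ _ _ gT.
have cG : coupling LP LQ G.
  (* The first marginal is [k P + (1 - k) P = P], as [D] has mass [1 - k]; the second is [k P + D],
     as [P] has mass 1. *)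
  move=> A mA; split.
    rewrite GE gE// setIT LPE// preimage_setT DT.
    rewrite -ge0_muleDl ?lee_fin ?subr_ge0//.
    by rewrite -EFinD subrKC mul1e.
  by rewrite GE gE// setTI LQE// preimage_setT PT mule1.
apply: (@le_trans _ _ (\int[G]_u ground_cost u.1 u.2)%E).
  by apply: ereal_inf_lbound; exists G.
have mc := measurable_ground_cost R d.
have c0 (u : out_space R d * out_space R d) : (0 <= ground_cost u.1 u.2)%E.
  by rewrite lee_fin sqrtr_ge0.
have I1 : (\int[g1 mdiag]_u ground_cost u.1 u.2 = 0)%E.
  rewrite ge0_integral_pushforward// preimage_setT integral0_eq// => s _.
  rewrite /= /ground_cost /dist2 big1 ?sqrtr0// => i _.
  by rewrite subrr expr0n.
have DPT : (D \x P')%E setT = (1 - k)%:E.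
  rewrite -setXTT product_measure1E// DT.
  by rewrite [X in (_ * X)%E]probability_setT mule1.
have I2 : (\int[g2 mswap]_u ground_cost u.1 u.2 <= (M * (1 - k))%:E)%E.
  rewrite ge0_integral_pushforward// preimage_setT.
  apply: (@le_trans _ _ (\int[D \x P']_u M%:E)%E).
    apply: ge0_le_integral => //=.
    - by move=> u _; exact: (c0 (h u.2, h u.1)).
    - exact: (measurableT_comp mc mswap).
    - by move=> u _; rewrite lee_fin.
  by rewrite integral_cst// [X in (_ * X)%E]DPT EFinM.
rewrite (@eq_measure_integral _ _ _ setT g); last by move=> A _ _; exact: GE.
rewrite ge0_integral_measure_add// ge0_integral_mscale//=.
by rewrite I1 mule0 add0e.
Qed.

(** * Joint laws given by densities in features, exposure and treatment *)

Section mixture.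
Context {R : realType} {dX : measure_display} {X : measurableType dX}
  (PX : probability X R).
(* [lebesgue_measure] lives on this alias of [R]. *)
Local Notation RT := (measurableTypeR R).

(** This is the measure with density [f] with respect to [PX], Lebesgue measure on [0,1] and
    counting measure on treatments. Keeping [t] last makes each treatment slice a subset of the
    product carrying [PX \x lebesgue_measure]. *)
Definition mixture (f : bool -> X * RT -> \bar R)
    (A : set ((X * RT) * bool)) : \bar R :=
  (\sum_(t : bool) \int[PX \x lebesgue_measure]_(p in
      [set p | A (p, t)] `&` (setT `*` `[0%R, 1%R])) f t p)%E.

Let measurable_slice (A : set ((X * RT) * bool)) t : measurable A ->
  measurable [set p | A (p, t)].
Proof.
move=> mA; have mpair : measurable_fun setT (fun p : X * RT => (p, t)).
  exact: measurable_fun_pair.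
by rewrite -[X in measurable X]setTI; exact: mpair.
Qed.

Let measurable_slab : measurable (setT `*` `[0%R, 1%R] : set (X * RT)).
Proof. exact: measurableX. Qed.

(** Each treatment contributes a density measure restricted to the slab and pushed forward to its
    own slice. *)
Lemma mixture_measure (f : bool -> X * RT -> \bar R) :
  (forall t, measurable_fun setT (f t)) -> (forall t p, 0 <= f t p)%E ->
  exists m : {measure set ((X * RT) * bool) -> \bar R},
    forall A, measurable A -> m A = mixture f A.
Proof.
move=> mf f0.
have [nu nuE] : exists nu : bool -> {measure set (X * RT) -> \bar R},
    forall t A, nu t A = (\int[PX \x lebesgue_measure]_(p in A) f t p)%E.
  have /choice[nu nuE] t := induced_measure _ _ _ (PX \x lebesgue_measure)%E
    (f t) (mf t) (f0 t).
  by exists nu.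
have mpair (t : bool) : measurable_fun setT (fun p : X * RT => (p, t)).
  exact: measurable_fun_pair.
pose m t : {measure set ((X * RT) * bool) -> \bar R} :=
  pushforward (mrestr (nu t) measurable_slab) (fun p => (p, t)).
exists (measure_add (m mpair true) (m mpair false)) => A mA.
etransitivity; first exact: measure_addE.
by rewrite /mixture big_bool /= /pushforward /mrestr !nuE.
Qed.

(** Tonelli with [z] outermost, the order of integration used in [law_prod] and [law_q]. *)
Lemma mixtureE (f : bool -> X * RT -> \bar R)
    (A : set ((X * RT) * bool)) :
  (forall t, measurable_fun setT (f t)) -> (forall t p, 0 <= f t p)%E ->
  measurable A ->
  mixture f A = (\sum_(t : bool) \int[lebesgue_measure]_(z in `[0%R, 1%R])
    \int[PX]_x (f t (x, z) * (\1_A ((x, z), t))%:E))%E.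
Proof.
move=> mf f0 mA; apply: eq_bigr => t _.
rewrite integral_mkcond fubini_tonelli2; last 2 first.
- apply/(measurable_restrictT _ _).1 => //.
    by apply: measurableI => //; exact: measurable_slice.
  exact: measurable_funTS.
- by move=> p; rewrite erestrict_ge0.
rewrite [RHS]integral_mkcond; apply: eq_integral => z _.
rewrite patchE /fubini_G; case: ifPn => [/set_mem z01|/negP z01].
  apply: eq_integral => x _; rewrite patchE indicE.
  have -> : ((x, z) \in [set p | A (p, t)] `&` (setT `*` `[0%R, 1%R])) =
            ((x, z, t) \in A).
    by apply/idP/idP => /set_mem; [case=> /= ? _|move=> ?]; apply/mem_set.
  by case: ifP; rewrite (mule1, mule0).
rewrite integral0_eq// => x _; rewrite patchE ifN//.
by apply/negP => /set_mem[_ [_ /= z01']]; apply: z01; exact/mem_set.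
Qed.

(** Tonelli in the opposite order: at fixed [x], the normalisation of the conditional law of [z]
    becomes applicable. *)
Lemma mixtureT (f : bool -> X * RT -> \bar R) :
  (forall t, measurable_fun setT (f t)) -> (forall t p, 0 <= f t p)%E ->
  mixture f setT = (\sum_(t : bool)
    \int[PX]_x \int[lebesgue_measure]_(z in `[0%R, 1%R]) f t (x, z))%E.
Proof.
move=> mf f0; apply: eq_bigr => t _.
have -> : [set p : X * RT | [set: (X * RT) * bool]
  (p, t)] = setT by [].
rewrite setTI integral_mkcond fubini_tonelli1; last 2 first.
- by apply/(measurable_restrictT _ _).1 => //; exact: measurable_funTS.
- by move=> p; rewrite erestrict_ge0.
apply: eq_integral => x _.
rewrite [RHS]integral_mkcond; apply: eq_integral => z _.
by rewrite !patchE in_setX in_setT.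
Qed.

Lemma mixtureD (k : R) (f g : bool -> X * RT -> \bar R)
    (A : set ((X * RT) * bool)) : 0 <= k ->
  (forall t, measurable_fun setT (f t)) -> (forall t p, 0 <= f t p)%E ->
  (forall t, measurable_fun setT (g t)) -> (forall t p, 0 <= g t p)%E ->
  measurable A ->
  mixture (fun t p => k%:E * f t p + g t p)%E A
    = (k%:E * mixture f A + mixture g A)%E.
Proof.
move=> k0 mf f0 mg g0 mA; rewrite /mixture !big_bool /=.
have mAt t : measurable ([set p | A (p, t)] `&` (setT `*` `[0%R, 1%R])).
  by apply: measurableI => //; exact: measurable_slice.
have key t :
  (\int[PX \x lebesgue_measure]_(p in
      [set p | A (p, t)] `&` (setT `*` `[0%R, 1%R])) (k%:E * f t p + g t p) =
   k%:E * \int[PX \x lebesgue_measure]_(p in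
      [set p | A (p, t)] `&` (setT `*` `[0%R, 1%R])) f t p +
   \int[PX \x lebesgue_measure]_(p in
      [set p | A (p, t)] `&` (setT `*` `[0%R, 1%R])) g t p)%E.
  rewrite ge0_integralD//.
  - rewrite ge0_integralZl// ?lee_fin//; exact: measurable_funTS.
  - by move=> p _; rewrite mule_ge0.
  - by apply: measurable_funeM; exact: measurable_funTS.
  - exact: measurable_funTS.
rewrite !key addeACA -ge0_muleDr //.
- by apply: integral_ge0 => p _.
- by apply: integral_ge0 => p _.
Qed.

End mixture.

(** * Bounds and measurability for inverse weights *)

(** The middle term is the inverse of the product of the two ratios, and inversion maps the interval
    [[1/(A B), A B]] to itself. *)
Lemma inv_ratio_bounds (R : realFieldType) (a a' b b' A B : R) :
  0 < a -> 0 < a' -> 0 < b -> 0 < b' -> 0 < A -> 0 < B ->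
  A^-1 <= a' / a <= A -> B^-1 <= b' / b <= B ->
  (A * B)^-1 <= (b' * a')^-1 * (b * a) <= A * B.
Proof.
move=> a0 a'0 b0 b'0 A0 B0 /andP[la ua] /andP[lb ub].
have -> : (b' * a')^-1 * (b * a) = ((a' / a) * (b' / b))^-1.
  by field; rewrite !gt_eqF.
have p0 : 0 < (a' / a) * (b' / b) by rewrite !mulr_gt0 ?invr_gt0.
apply/andP; split.
  rewrite lef_pV2 ?posrE//; last exact: mulr_gt0.
  by apply: ler_pM => //; apply/ltW; rewrite divr_gt0.
rewrite invf_ple ?posrE//; last exact: mulr_gt0.
by rewrite invfM; apply: ler_pM => //; apply/ltW; rewrite invr_gt0.
Qed.

(** The absolute value makes the base nonnegative, so that the inverse is the real power with
    exponent -1. *)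
Lemma measurable_invr_norm (R : realType) (d : measure_display)
  (T : measurableType d) (f : T -> R) :
  measurable_fun setT f -> measurable_fun setT (fun x => `|f x|^-1).
Proof.
move=> mf; under eq_fun do rewrite -powR_inv1//.
by apply: (measurableT_comp (measurable_powR _)); exact: measurableT_comp.
Qed.

Theorem theorem2 (R : realType) (dX dt dz : measure_display)
  (X : measurableType dX) (Xt : measurableType dt) (Xz : measurableType dz)
  (PX : probability X R) (pt : X -> Xt) (pz : X -> Xz)
  (e : bool -> Xt -> R) (phi : R -> Xz -> R)
  (eh : bool -> Xt -> R) (phih : R -> Xz -> R)
  (Gt Gz : R) (d : nat) (Phi : X -> d.-tuple R) (calR : set (d.-tuple R)) :
  (* measurability (regularity implicit in the paper) *)
  measurable_fun setT pt -> measurable_fun setT pz ->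
  (forall t, measurable_fun setT (e t)) ->
  (forall t, measurable_fun setT (eh t)) ->
  measurable_fun setT (fun p : Xz * R => phi p.2 p.1) ->
  measurable_fun setT (fun p : Xz * R => phih p.2 p.1) ->
  (* e(t;x_t) = p(t|x_t) and phi(z;x_z) = p(z|x_z) are conditional laws *)
  (forall x, e true (pt x) + e false (pt x) = 1) ->
  (forall x, (\int[lebesgue_measure]_(z in `[0%R, 1%R]) (phi z (pz x))%:E)%E
               = 1%E) ->
  (* overlap: p(t,z|x) = phi(z;x_z) e(t;x_t) > 0 *)
  (forall x t, 0 < e t (pt x)) ->
  (forall x z, z \in `[0, 1] -> 0 < phi z (pz x)) ->
  (* positive estimates *)
  (forall x t, 0 < eh t (pt x)) ->
  (forall x z, z \in `[0, 1] -> 0 < phih z (pz x)) ->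
  (* bounded odds-ratio condition *)
  1 <= Gt -> 1 <= Gz ->
  (forall x t, Gt^-1 <= eh t (pt x) / e t (pt x) <= Gt) ->
  (forall x z, z \in `[0, 1] ->
     Gz^-1 <= phih z (pz x) / phi z (pz x) <= Gz) ->
  (* one-to-one representation into a bounded calR *)
  measurable_fun setT Phi -> injective Phi ->
  (forall x, calR (Phi x)) ->
  (exists M : R, forall r r', calR r -> calR r' -> dist2 r r' <= M) ->
  (W1 (law_prod PX pt pz e phi Phi)
      (law_q PX pt pz e phi eh phih Phi)
    <= (diam calR * Num.sqrt (ln Gt + ln Gz))%:E)%E.
Proof.
move=> mpt mpz me meh mphi mphih e1 phi1 e0 phi0 eh0 phih0 Gt1 Gz1 hGt hGz.
move=> mPhi _ hcalR [M0 hM0].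
pose T := measurableTypeR R.
set G := Gt * Gz.
have Gt0 : 0 < Gt by exact: lt_le_trans Gt1.
have Gz0 : 0 < Gz by exact: lt_le_trans Gz1.
have G0 : 0 < G by rewrite mulr_gt0.
set k := (G^-1) ^+ 2.
have k01 : 0 <= k <= 1.
  by rewrite exprn_ge0 ?exprn_ile1 ?invr_ge0 ?invf_le1 ?mulr_ege1// ltW.
(* absolute values make the densities nonnegative also off [0,1], where [phi]
   and [phih] are unconstrained *)
pose ps t (p : X * T) := `|psi pt pz e phi p.1 t p.2|.
pose v t (p : X * T) := `|(phih p.2 (pz p.1) * eh t (pt p.1))|^-1 * ps t p.
pose pp t (z : T) := (\int[PX]_x (ps t (x, z))%:E)%E.
pose cc t (z : T) := (\int[PX]_x (v t (x, z))%:E)%E.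
(* [fP] is constant in [x] because features and [(t, z)] are independent under the first law; [fD]
   is the density of the remainder [D]. *)
pose fP t (p : X * T) := pp t p.2.
pose fD t (p : X * T) :=
  (pp t p.2 * (`|v t p * (fine (cc t p.2))^-1 - k|)%:E)%E.
have mpt' : measurable_fun setT (fun p : X * T => pt p.1).
  exact: (measurableT_comp mpt).
have mpz' : measurable_fun setT (fun p : X * T => (pz p.1, p.2)).
  by apply: measurable_fun_pair => //; exact: (measurableT_comp mpz).
have mps t : measurable_fun setT (ps t).
  apply: measurableT_comp => //; apply: measurable_funM.
    exact: (measurableT_comp mphi mpz').
  exact: (measurableT_comp (me t) mpt').
have mv t : measurable_fun setT (v t).
  apply: measurable_funM => //; apply: measurable_invr_norm.
  apply: measurable_funM.
    exact: (measurableT_comp mphih mpz').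
  exact: (measurableT_comp (meh t) mpt').
have ps0 t p : 0 <= ps t p by rewrite normr_ge0.
have v0 t p : 0 <= v t p by rewrite mulr_ge0// invr_ge0.
have mpp t : measurable_fun setT (pp t).
  apply: (@measurable_fun_fubini_tonelli_G _ _ X T R PX
    (fun p => (ps t p)%:E)); first exact/measurable_EFinP.
  by move=> p; rewrite lee_fin.
have mcc t : measurable_fun setT (cc t).
  apply: (@measurable_fun_fubini_tonelli_G _ _ X T R PX
    (fun p => (v t p)%:E)); first exact/measurable_EFinP.
  by move=> p; rewrite lee_fin.
have pp0 t z : (0 <= pp t z)%E.
  by apply: integral_ge0 => x _; rewrite lee_fin.
have mfP t : measurable_fun setT (fP t) by exact: (measurableT_comp (mpp t)).
have mcV t : measurable_fun setT (fun p : X * T => (fine (cc t p.2))^-1).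
  have -> : (fun p : X * T => (fine (cc t p.2))^-1) =
            (fun p : X * T => `|fine (cc t p.2)|^-1).
    apply/funext => p; rewrite ger0_norm// fine_ge0//.
    by apply: integral_ge0 => x _; rewrite lee_fin.
  apply: measurable_invr_norm.
  apply: (measurableT_comp (@fine_measurable R setT measurableT)).
  exact: (measurableT_comp (mcc t)).
have mfD t : measurable_fun setT (fD t).
  apply: emeasurable_funM; first exact: mfP.
  apply/measurable_EFinP; apply: measurableT_comp => //.
  by apply: measurable_funB => //; exact: measurable_funM.
have fP0 t p : (0 <= fP t p)%E by exact: pp0.
have fD0 t p : (0 <= fD t p)%E by rewrite mule_ge0.
have psE t x z : z \in `[0, 1] -> ps t (x, z) = psi pt pz e phi x t z.
  by move=> z01; rewrite /ps ger0_norm// mulr_ge0// ltW// phi0.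
have vE t x z : z \in `[0, 1] ->
    v t (x, z) = w_eta pt pz eh phih t z x * psi pt pz e phi x t z.
  by move=> z01; rewrite /v psE//= ger0_norm// mulr_ge0// ltW// phih0.

(* Pointwise bounds on the reweighted density *)
have vG t x z : z \in `[0, 1] -> G^-1 <= v t (x, z) <= G.
  move=> z01; rewrite vE//; apply: inv_ratio_bounds; rewrite ?phi0 ?phih0//.
  exact: hGz.
have ppE t z : z \in `[0, 1] -> pp t z = p_tz PX pt pz e phi t z.
  by move=> z01; apply: eq_integral => x _; rewrite psE.
have ccE t z : z \in `[0, 1] -> cc t z = cp_tz PX pt pz e phi eh phih t z.
  by move=> z01; apply: eq_integral => x _; rewrite vE.
have mvz t z : measurable_fun setT (fun x => v t (x, z)).
  exact: (measurable_fun_pair1 _ (mv t)).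
have ccG t z : z \in `[0, 1] -> ((G^-1)%:E <= cc t z <= G%:E)%E.
  move=> z01; have cstE r : (\int[PX]_x r%:E = r%:E)%E.
    by rewrite integral_cst// [X in (_ * X)%E]probability_setT mule1.
  rewrite -[X in (X <= _ <= _)%E]cstE -[X in (_ <= _ <= X)%E]cstE.
  apply/andP; split; apply: ge0_le_integral => //=.
  - by move=> x _; rewrite lee_fin invr_ge0 ltW.
  - exact/measurable_EFinP.
  - by move=> x _; rewrite lee_fin; have /andP[] := vG t x z z01.
  - by move=> x _; rewrite lee_fin.
  - exact/measurable_EFinP.
  - by move=> x _; rewrite lee_fin; have /andP[] := vG t x z z01.
(* Finiteness keeps [fine] from returning its default value 0, so dividing by it does normalise. *)
have ccfin t z : z \in `[0, 1] -> cc t z = (fine (cc t z))%:E.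
  move=> /(ccG t)/andP[cl cu]; rewrite fineK// ge0_fin_numE.
    by rewrite (le_lt_trans cu) ?ltry.
  by rewrite (le_trans _ cl)// lee_fin invr_ge0 ltW.
have cfG t z : z \in `[0, 1] -> G^-1 <= fine (cc t z) <= G.
  by move=> z01; rewrite -!lee_fin -ccfin//; exact: ccG.
have cf0 t z : z \in `[0, 1] -> 0 < fine (cc t z).
  by move=> /(cfG t)/andP[cl _]; rewrite (lt_le_trans _ cl)// invr_gt0.
(* The absolute value in [fD] disappears here: [v >= 1/G] and [1/c >= 1/G] give [v / c >= k]. *)
have fPD t x z : z \in `[0, 1] ->
    (k%:E * fP t (x, z) + fD t (x, z) =
     pp t z * ((fine (cc t z))^-1%R * v t (x, z))%:E)%E.
  move=> z01; rewrite /fP /fD /= muleC -ge0_muleDr ?lee_fin//; last first.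
    by case/andP: k01.
  congr (_ * _)%E; rewrite -EFinD ger0_norm ?subrKC 1?mulrC// subr_ge0.
  rewrite /k expr2; apply: ler_pM; rewrite ?invr_ge0 ?(ltW G0)//.
    by rewrite lef_pV2 ?posrE// ?cf0//; case/andP: (cfG t z z01).
  by case/andP: (vG t x z z01).

(* Both laws as images of mixtures *)
have [P PE] := mixture_measure PX fP mfP fP0.
have [D DE] := mixture_measure PX fD mfD fD0.
pose h (p : (X * T) * bool) : out_space R d := ((Phi p.1.1, p.2), p.1.2).
have mh : measurable_fun setT h.
  apply: measurable_fun_pair; last exact: (measurableT_comp measurable_snd).
  apply: measurable_fun_pair => //.
  apply: (measurableT_comp mPhi).
  exact: (measurableT_comp measurable_fst).
have mpre A : measurable A -> measurable (h @^-1` A).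
  by move=> mA; rewrite -[X in measurable X]setTI; exact: mh.
have mind (t : bool) (z : R) A : measurable A ->
    measurable_fun setT (fun x => \1_A ((Phi x, t), z) : R).
  move=> mA; have mxh : measurable_fun setT (fun x => ((Phi x, t), z)).
    by apply: measurable_fun_pair => //; exact: measurable_fun_pair.
  exact: (measurableT_comp (measurable_indic mA) mxh).
have PE' A : measurable A -> law_prod PX pt pz e phi Phi A = P (h @^-1` A).
  move=> mA; rewrite PE; last exact: mpre.
  rewrite mixtureE; [|exact: mfP|exact: fP0|exact: mpre].
  apply: eq_bigr => t _; apply: eq_integral => z /set_mem/= z01.
  rewrite -ppE// -(@ge0_integralZl _ _ _ PX setT measurableT
    (fun x => (\1_A ((Phi x, t), z))%:E))//.
  by apply/measurable_EFinP; exact: mind.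
pose fQ t p := (k%:E * fP t p + fD t p)%E.
have mfQ t : measurable_fun setT (fQ t).
  by apply: emeasurable_funD => //; exact: measurable_funeM.
have fQ0 t p : (0 <= fQ t p)%E.
  by rewrite adde_ge0// mule_ge0// lee_fin; case/andP: k01.
have QE A : measurable A ->
    law_q PX pt pz e phi eh phih Phi A
      = (k%:E * P (h @^-1` A) + D (h @^-1` A))%E.
  move=> mA; rewrite PE ?DE; [|exact: mpre..].
  rewrite -mixtureD//; [|by case/andP: k01|exact: mpre].
  rewrite mixtureE//; last exact: mpre.
  apply: eq_bigr => t _; apply: eq_integral => z /set_mem/= z01.
  have mint : measurable_fun setT (fun x => (w_eta pt pz eh phih t z x *
      psi pt pz e phi x t z * \1_A ((Phi x, t), z))%:E).
    apply/measurable_EFinP; apply: measurable_funM => //; last exact: mind.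
    rewrite (_ : (fun _ => _) = (fun x => v t (x, z)))//.
    by apply/funext => x; rewrite vE.
  have int0 x : (0 <= (w_eta pt pz eh phih t z x *
      psi pt pz e phi x t z * \1_A ((Phi x, t), z))%:E)%E.
    by rewrite lee_fin mulr_ge0// -vE.
  have ci0 : (0 <= ((fine (cc t z))^-1%R)%:E)%E.
    by rewrite lee_fin invr_ge0 ltW// cf0.
  (* The factors [1/c] and [p(t,z)] are constant in [x] and move under the integral, where [fPD]
     applies pointwise. *)
  rewrite -ppE// -ccE// muleC [X in (X * _)%E]muleC.
  rewrite -(@ge0_integralZl _ _ _ PX setT _ _ mint)//.
  rewrite muleC -(@ge0_integralZl _ _ _ PX setT)//; last 2 first.
  - exact: measurable_funeM.
  - by move=> x _; rewrite mule_ge0.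
  apply: eq_integral => x _; rewrite fPD// -muleA; congr (_ * _)%E.
  by rewrite -!EFinM vE// mulrA.

(* Total masses *)
have PT : P setT = 1%E.
  rewrite PE// mixtureE//.
  (* The density [p(t,z)] is itself the mean of [ps] over [x], so [fP] and [ps] have equal mass. For
     [ps] the integral over [z] leaves [e], which sums to 1 over treatments. *)
  have -> : (\sum_(t : bool) \int[lebesgue_measure]_(z in `[0%R, 1%R])
      \int[PX]_x (fP t (x, z) * (\1_setT ((x, z), t))%:E) =
      mixture PX (fun t p => (ps t p)%:E) setT)%E.
    rewrite mixtureE//; last by move=> t; exact/measurable_EFinP.
    apply: eq_bigr => t _; apply: eq_integral => z _.
    under eq_integral do rewrite indicT mule1.
    under [RHS]eq_integral do rewrite indicT mule1.
    by rewrite /fP/= integral_cst// [X in (_ * X)%E]probability_setT mule1.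
  rewrite mixtureT//; last by move=> t; exact/measurable_EFinP.
  have phiE t x : (\int[lebesgue_measure]_(z in `[0%R, 1%R]) (ps t (x, z))%:E =
      (e t (pt x))%:E)%E.
    under eq_integral => z /set_mem/= z01 do rewrite psE// /psi mulrC EFinM.
    rewrite ge0_integralZl//; first by rewrite phi1 mule1.
    - apply/measurable_EFinP; apply: measurable_funTS.
      exact: (measurable_fun_pair2 _ mphi).
    - by move=> z z01; rewrite lee_fin ltW// phi0.
    - by rewrite lee_fin ltW.
  rewrite big_bool /= !(eq_integral _ _ (fun x _ => phiE _ x)).
  have met t : measurable_fun setT (fun x => (e t (pt x))%:E).
    by apply/measurable_EFinP; exact: measurableT_comp.
  rewrite -ge0_integralD//; try by move=> x _; rewrite lee_fin ltW.
  under eq_integral do rewrite -EFinD e1.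
  by rewrite integral_cst// [X in (_ * X)%E]probability_setT mule1.
(* For each [(t, z)] the factor [v / c] has mean 1 in [x], so reweighting preserves the law of
   [(t, z)]. *)
have QT : mixture PX fQ setT = mixture PX fP setT.
  rewrite !mixtureE//.
  apply: eq_bigr => t _; apply: eq_integral => z /set_mem/= z01.
  under eq_integral do rewrite /fQ fPD// indicT mule1 EFinM.
  under [RHS]eq_integral do rewrite indicT mule1.
  rewrite /fP/= integral_cst// [X in (_ * X)%E]probability_setT.
  have ci0 : (0 <= ((fine (cc t z))^-1%R)%:E)%E.
    by rewrite lee_fin invr_ge0 ltW// cf0.
  have mvE : measurable_fun setT (fun x => (v t (x, z))%:E).
    exact/measurable_EFinP.
  rewrite ge0_integralZl//; last 2 first.
  - exact: measurable_funeM.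
  - by move=> x _; rewrite mule_ge0// lee_fin.
  rewrite ge0_integralZl//; last by move=> x _; rewrite lee_fin.
  rewrite -/(cc t z) [X in (_ * X)%E](_ : _ = 1%E)//.
  by rewrite [X in (_ * X)%E]ccfin// -EFinM mulVf// gt_eqF// cf0.
have DT : D setT = (1 - k)%:E.
  have : (k%:E * P setT + D setT = 1)%E.
    rewrite PE// DE// -mixtureD//; last by case/andP: k01.
    by rewrite -/fQ QT -PE.
  rewrite PT mule1; case: (D setT) => [r| |]//= [kr].
  by congr EFin; lra.

(* Diameter and conclusion *)
(* The real [sup] is guaranteed to be an upper bound only for a set that is bounded above; [M0]
   provides this. *)
have dist_diam x y : dist2 (Phi x) (Phi y) <= diam calR.
  apply: ub_le_sup; last by exists (Phi x) => //; exists (Phi y).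
  by exists M0 => _ [r cr [r' cr' <-]]; exact: hM0.
have diam0 : 0 <= diam calR.
  by apply: le_trans (dist_diam point point); exact: sqrtr_ge0.
apply: le_trans (W1_le_of_minorization _ _ _ _ h P D _ _ k (diam calR)
  mh k01 diam0 PT DT PE' QE (fun s s' => dist_diam s.1.1 s'.1.1)) _.
rewrite lee_fin ler_wpM2l//.
have L0 : 0 <= ln Gt + ln Gz by rewrite addr_ge0 ?ln_ge0.
have -> : k = expR (- (2 * Num.sqrt (ln Gt + ln Gz) ^+ 2)).
  rewrite sqr_sqrtr// mulrC -mulNr -[2]/(2%:R) expRM_natr expRN expRD.
  by rewrite !lnK ?posrE.
by apply: one_sub_expRN_le; exact: sqrtr_ge0.
Qed.
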